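(* Let $X$ be an infinite-dimensional Banach space. Then there is a Banach space $Y$ isomorphic to $X$ such that $\operatorname{QMA}(X,Y)\neq\mathcal{L}(X,Y)$.
   Context: Banach spaces are over $\mathbb{K}=\mathbb{R}$ or $\mathbb{C}$. $\mathcal{L}(X,Y)$ is the space of bounded linear operators from $X$ to $Y$; $S_X$ is the unit sphere of $X$. For $T\in\mathcal{L}(X,Y)$ the minimum norm is $m(T):=\inf\{\|T(x)\|: x\in S_X\}$. An operator $T\in\mathcal{L}(X,Y)$ is quasi minimum-attaining if there are a sequence $(x_n)_n\subset S_X$ and a point $y\in m(T)\cdot S_Y$ such that $T(x_n)$ converges to $y$; $\operatorname{QMA}(X,Y)$ is the set of all such operators. ''Isomorphic'' means linearly isomorphic (linear homeomorphism). *)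

(* Defs.v *)
From HB Require Import structures.
From mathcomp Require Import all_boot all_order all_algebra.
From mathcomp Require Import all_classical all_reals all_analysis.

Set Implicit Arguments.
Unset Strict Implicit.
Unset Printing Implicit Defensive.

Import Order.TTheory GRing.Theory Num.Theory.
Import numFieldNormedType.Exports.

Local Open Scope classical_set_scope.
Local Open Scope ring_scope.

Definition infinite_dimensional (K : numFieldType) (X : lmodType K) : Prop :=
  ~ exists s : seq X, forall x : X,
      exists a : 'I_(size s) -> K, x = \sum_(i < size s) a i *: s`_i.

Section operators.
Context {K : numFieldType}.
Implicit Types X Y : completeNormedModType K.

Definition unit_sphere X : set X := [set x | `|x| = 1].
Arguments unit_sphere : clear implicits.

Definition bounded_operators X Y : set {linear X -> Y} :=
  [set T | exists M : K, forall x : X, `|T x| <= M * `|x|].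
Arguments bounded_operators : clear implicits.

(* Norms take their values in K.  For K = R[i] the order of K is the partial
   one (z <= w iff w - z is a nonnegative real), so every lower bound of a
   nonempty set of reals is real and the greatest one is the usual infimum. *)
Definition minimum_norm X Y (T : {linear X -> Y}) : K :=
  infimum 0 [set `|T x| | x in unit_sphere X].

Definition QMA X Y : set {linear X -> Y} :=
  [set T | bounded_operators X Y T /\
    exists (x : nat -> X) (y : Y),
      [/\ forall n, unit_sphere X (x n),
          [set minimum_norm T *: z | z in unit_sphere Y] y &
          T (x n) @[n --> \oo] --> y]].
Arguments QMA : clear implicits.

Definition isomorphic X Y : Prop :=
  exists (f : {linear X -> Y}) (g : {linear Y -> X}),
    [/\ cancel f g, cancel g f, continuous f & continuous g].

End operators.

Arguments unit_sphere {K} X.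
Arguments bounded_operators {K} X Y.
Arguments QMA {K} X Y.
Arguments isomorphic {K} X Y.

(* Main.v *)
(* Let [q] be a continuous norm on [X] that is strictly weaker than the given
   one, and let [Y] be [X] with the equivalent norm [N x = `|x| + q x].  The
   identity [X -> Y] has minimum norm 1, but [N x > 1] on the whole unit sphere
   of [X]; as a norm-convergent minimizing sequence would have its limit on
   that sphere, the identity is not quasi minimum-attaining.

   To find [q], take a linearly independent sequence with span [V], a dense
   sequence [d j] of [V], and functionals [f j] of norm at most 2 with
   [`|f j (d j)| >= `|d j|].  The [f j] separate the points of the closure of
   [V], so [q x = max (dist x V) (sup_j 2^-(j+1) `|f j x|)] is a norm; it is at
   most [2^-n] at a unit vector of [V] killed by [f 0, ..., f (n-1)]. *)

Require Import Defs.
From mathcomp Require Import all_boot all_order all_algebra.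
From mathcomp Require Import complex.
From mathcomp Require Import all_classical all_reals all_analysis.
From HB Require Import structures.

Set Implicit Arguments.
Unset Strict Implicit.
Unset Printing Implicit Defensive.

Import Order.TTheory GRing.Theory Num.Theory.
Import numFieldNormedType.Exports.

Local Open Scope classical_set_scope.
Local Open Scope ring_scope.

Local Notation Re := complex.Re.
Local Notation Im := complex.Im.

(** * Equivalent renormings and quasi minimum attainment *)

(** A copy of [X] labelled by [N], so that a second norm can be declared on the same vector space
    without clashing with the first. *)
Definition renormed (K : numFieldType) (X : lmodType K) (N : X -> K) : Type :=
  X.

HB.instance Definition _ (K : numFieldType) (X : lmodType K) (N : X -> K) :=
  GRing.Lmodule.copy (renormed N) X.

Lemma bounded_by_continuous (K : numFieldType) (X Y : normedModType K)
    (f : {linear X -> Y}) (C : K) :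
  0 <= C -> (forall x, `|f x| <= C * `|x|) -> continuous f.
Proof.
move=> C0 fC; apply/linear_bounded_continuous/linear_boundedP.
near=> r => x; apply: (le_trans (fC x)); apply: ler_wpM2r => //.
near: r; apply: nbhs_pinfty_ge; exact: ger0_real.
Unshelve. all: by end_near. Qed.

(** Completeness passes to [N]: an [N]-Cauchy filter is Cauchy in [X] because [N] dominates the
    norm, and its limit there is an [N]-limit because the identity into the new space is
    continuous. *)
Lemma renorming (K : numFieldType) (X : completeNormedModType K) (N : X -> K)
    (C : K) :
  (forall x y, N (x + y) <= N x + N y) ->
  (forall a x, N (a *: x) = `|a| * N x) ->
  (forall x, `|x| <= N x) -> (forall x, N x <= C * `|x|) ->
  exists (Y : completeNormedModType K) (f : {linear X -> Y})
    (g : {linear Y -> X}),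
    [/\ cancel f g, cancel g f, continuous f, continuous g
      & forall x, `|f x| = N x].
Proof.
move=> ND NZ Nge Nle.
have N0 (x : X) : N x = 0 -> x = 0.
  by move=> Nx; apply/normr0_eq0/le_anti; rewrite normr_ge0 andbT -Nx Nge.
pose Y0 : normedModType K := HB.pack (renormed N)
  (@Lmodule_isNormed.Build K (renormed N) N ND NZ N0).
pose f0 (x : X) : Y0 := x.
have f0_linear : linear f0 by [].
pose F : {linear X -> Y0} :=
  HB.pack f0 (GRing.isLinear.Build _ _ _ _ f0 f0_linear).
pose g0 (x : Y0) : X := x.
have g0_linear : linear g0 by [].
pose G : {linear Y0 -> X} :=
  HB.pack g0 (GRing.isLinear.Build _ _ _ _ g0 g0_linear).
(* [C] itself carries no sign, so [|C|] replaces it as the Lipschitz constant. *)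
have C0 : 0 <= `|C| by [].
have Nle' x : N x <= `|C| * `|x|.
  have N_ge0 y : 0 <= N y by apply: le_trans (Nge y).
  have := Nle x; rewrite -(ger0_norm (N_ge0 x)) => h.
  have : `|C * `|x| | = C * `|x| by rewrite ger0_norm // (le_trans _ h).
  by rewrite normrM normr_id => ->.
have cF : continuous F by apply: (bounded_by_continuous C0).
have cG : continuous G.
  apply: (@bounded_by_continuous _ _ _ _ 1) => // x.
  by rewrite mul1r; exact: Nge.
have Ycomplete (H : set_system Y0) : ProperFilter H -> cauchy H -> cvg H.
  move=> PH /cauchy_ballP cH.
  have cGH : cauchy (G @ H).
    apply/cauchy_exP => e e0.
    have /cauchy_ballP /cauchyP /(_ e e0) [y Hy] := cH.
    exists (y : X).
    apply: filterS Hy => z.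
    by rewrite -!ball_normE /= => /(le_lt_trans (Nge _)).
  have /cvg_ex [l Hl] : cvg (G @ H) by apply: cauchy_cvg.
  apply/cvg_ex; exists (F l).
  have := cvg_comp _ _ Hl (cF l).
  exact.
pose Y : completeNormedModType K := HB.pack (Y0 : Type)
  (NormedModule.class Y0) (Uniform_isComplete.Build Y0 Ycomplete).
by exists Y, F, G; split.
Qed.

Lemma ler_addgt0_real (K : numFieldType) (a b : K) :
  a \is Num.real -> b \is Num.real ->
  (forall e, 0 < e -> a <= b + e) -> a <= b.
Proof.
move=> ar br h; rewrite real_leNgt//; apply/negP => ba.
have e0 : 0 < (a - b) / 2 by rewrite divr_gt0// subr_gt0.
have := h _ e0; apply/negP; rewrite -real_ltNge ?realD//.
  by rewrite -ltrBrDl gtr_pMr ?subr_gt0// invf_lt1// ltr1n.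
exact: gtr0_real.
Qed.

Lemma strictly_weaker_norm_not_QMA (K : numFieldType)
    (X : completeNormedModType K) (q : X -> K) (C : K) :
  (forall x y, q (x + y) <= q x + q y) ->
  (forall a x, q (a *: x) = `|a| * q x) ->
  (forall x, 0 <= q x) -> (forall x, q x = 0 -> x = 0) ->
  (forall x, q x <= C * `|x|) ->
  (forall e, 0 < e -> exists2 x, `|x| = 1 & q x <= e) ->
  exists Y : completeNormedModType K,
    isomorphic X Y /\ QMA X Y <> bounded_operators X Y.
Proof.
move=> qD qZ q0 q_eq0 qle q_small.
pose N x := `|x| + q x.
have ND x y : N (x + y) <= N x + N y.
  by rewrite /N addrACA lerD// ler_normD.
have NZ a x : N (a *: x) = `|a| * N x by rewrite /N normrZ qZ mulrDr.
have Nge x : `|x| <= N x by rewrite lerDl.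
have Nle x : N x <= (1 + C) * `|x| by rewrite mulrDl mul1r lerD2l.
have [Y [f [g [fK gK cf cg fE]]]] := renorming ND NZ Nge Nle.
exists Y; split; first by exists f, g.
have bf : bounded_operators X Y f by exists (1 + C) => x; rewrite fE.
move=> QE; move: bf; rewrite -QE => -[_ [x [y [x1 my xy]]]].
have m1 : minimum_norm f = 1.
  (* The sphere contains [x 0], so [infimum] does not take its default value. *)
  rewrite /minimum_norm /infimum; case: ifPn => [/eqP A0|_].
    have : [set `|f x| | x in unit_sphere X] `|f (x 0%N)| by exists (x 0%N).
    by rewrite A0.
  suff I1 : infimums [set `|f x| | x in unit_sphere X] 1.
    by apply: xget_unique => // b /is_subset1_infimums; apply.
  split=> [_ [z z1 <-]|b lb]; first by rewrite fE -z1.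
  have le e : 0 < e -> b <= 1 + e.
    move=> /q_small[z z1 qz].
    apply: (@le_trans _ _ `|f z|); first by apply: lb; exists z.
    by rewrite fE /N z1 lerD2l.
  (* The order may be partial; [b] is real because it is comparable with [1 + 1]. *)
  apply: ler_addgt0_real => //.
  have := le _ ltr01; move=> /ler_real ->.
  by rewrite realD.
move: my; rewrite m1 => -[z z1]; rewrite scale1r => zy.
have gy : g (f (x n)) @[n --> \oo] --> g y.
  by apply: continuous_cvg => //; exact: cg.
have g1 : `|g y| = 1.
  have : `|g (f (x n))| @[n --> \oo] --> `|g y| by apply: cvg_norm.
  under eq_fun do rewrite fK x1.
  by move=> /(@cvg_unique _ (@norm_hausdorff _ _)) /(_ (cvg_cst _)).
have : N (g y) = 1 by rewrite -fE gK -zy z1.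
rewrite /N g1 => /eqP; rewrite -subr_eq0 addrAC subrr add0r => /eqP /q_eq0 gy0.
by move: g1; rewrite gy0 normr0 => /eqP; rewrite eq_sym oner_eq0.
Qed.

(** * Construction of a strictly weaker norm from norming functionals *)

(* [P M x] reads "[x] lies in [M] times the unit ball"; the gauge is then the
   Minkowski functional of that ball. *)
Lemma gauge_seminorm (K : numFieldType) (X : lmodType K)
    (P : K -> X -> Prop) :
  (forall A : set K, A !=set0 -> lbound A 0 -> infimums A !=set0) ->
  (forall x, exists M, P M x) ->
  (forall M x, P M x -> 0 <= M) ->
  (forall M M' x y, P M x -> P M' y -> P (M + M') (x + y)) ->
  (forall M a x, P M x -> P (`|a| * M) (a *: x)) ->
  exists q : X -> K,
    [/\ forall x y, q (x + y) <= q x + q y,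
        forall a x, q (a *: x) = `|a| * q x,
        forall x, 0 <= q x,
        forall M x, P M x -> q x <= M &
        forall e x, q x < e -> exists2 M, P M x & M < e].
Proof.
move=> glb Pne P0 PD PZ.
pose q x := xget 0 (infimums [set M | P M x]).
have qP x : infimums [set M | P M x] (q x).
  rewrite /q; case: xgetP => [m _ //|].
  have [||m hm] := glb [set M | P M x]; first exact: Pne.
    by move=> M /P0.
  by move=> /(_ m).
have qle M x : P M x -> q x <= M by move=> h; apply: (qP x).1.
have qge b x : (forall M, P M x -> b <= M) -> b <= q x.
  by move=> h; apply: (qP x).2.
have q0 x : 0 <= q x by apply: qge => M /P0.
have qlt e x : q x < e -> exists2 M, P M x & M < e.
  move=> h; apply: contrapT => hM.
  have er : e \is Num.real by rewrite ger0_real// (le_trans (q0 x))// ltW.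
  have /qge : forall M, P M x -> e <= M.
    move=> M PM; rewrite real_leNgt//; last exact/ger0_real/(P0 _ _ PM).
    by apply/negP => Me; apply: hM; exists M.
  by move=> /(lt_le_trans h); rewrite ltxx.
have qZle a x : q (a *: x) <= `|a| * q x.
  have [->|a0] := eqVneq a 0.
    have [M PM] := Pne x.
    rewrite normr0 mul0r; apply: qle.
    by have := PZ _ 0 _ PM; rewrite normr0 mul0r.
  rewrite -ler_pdivrMl ?normr_gt0//; apply: (qge _ _) => M PM.
  by rewrite ler_pdivrMl ?normr_gt0//; apply: qle; apply: PZ.
exists q; split => //.
- move=> x y; rewrite -lerBlDr; apply: (qge _ _) => M PM.
  rewrite lerBlDl -lerBlDr; apply: (qge _ _) => M' PM'.
  by rewrite lerBlDl; apply/qle/PD.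
- move=> a x; apply/le_anti; rewrite qZle/=.
  have [->|a0] := eqVneq a 0; first by rewrite normr0 mul0r.
  rewrite -ler_pdivlMl ?normr_gt0// -normfV.
  (* The reverse inequality is [qZle] for the inverse scalar. *)
  by have := qZle a^-1 (a *: x); rewrite scalerA mulVf// scale1r.
Qed.

Inductive spanned (K : numFieldType) (X : lmodType K) (v : nat -> X) :
    X -> Prop :=
| spanned0 : spanned v 0
| spanned_cons a i y : spanned v y -> spanned v (a *: v i + y).

Lemma spannedD (K : numFieldType) (X : lmodType K) (v : nat -> X) x y :
  spanned v x -> spanned v y -> spanned v (x + y).
Proof.
move=> + sy; elim=> [|a i z _ IH]; first by rewrite add0r.
by rewrite -addrA; exact: spanned_cons.
Qed.

Lemma spannedZ (K : numFieldType) (X : lmodType K) (v : nat -> X) a x :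
  spanned v x -> spanned v (a *: x).
Proof.
elim=> [|b i z _ IH]; first by rewrite scaler0; exact: spanned0.
by rewrite scalerDr scalerA; exact: spanned_cons.
Qed.

Lemma spanned_sum (K : numFieldType) (X : lmodType K) (v : nat -> X) n
    (a : 'I_n -> K) :
  spanned v (\sum_(i < n) a i *: v i).
Proof.
elim/big_ind: _ => [|x y|i _]; [exact: spanned0|exact: spannedD|].
by rewrite -[X in spanned v X]addr0; exact/spanned_cons/spanned0.
Qed.

(** Some [g s] lies outside the span of each finite list [s]; appending [g s] over and over gives
    vectors each outside the span of the earlier ones. *)
Lemma infinite_dimensional_free (K : numFieldType) (X : lmodType K) :
  infinite_dimensional X ->
  exists v : nat -> X, forall n (a : 'I_n -> K),
    \sum_(i < n) a i *: v i = 0 -> forall i, a i = 0.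
Proof.
move=> Xinf.
have /choice[g gP] (s : seq X) : exists x : X,
    forall a : 'I_(size s) -> K, x <> \sum_(i < size s) a i *: s`_i.
  apply: contrapT => h; apply: Xinf; exists s => x; apply: contrapT => hx.
  by apply: h; exists x => a xa; apply: hx; exists a.
pose S n := iter n (fun s => rcons s (g s)) [::].
pose v n := g (S n).
have SE n : S n = mkseq v n.
  by elim: n => // n IH; rewrite mkseqS -IH.
have vP n (a : nat -> K) : v n <> \sum_(i < n) a i *: v i.
  have := gP (S n) (fun i => a i); rewrite -/(v n) SE size_mkseq => + vE.
  apply; rewrite {1}vE; apply: eq_bigr => i _.
  by rewrite nth_mkseq.
exists v => n a.
(* Coefficients indexed by [nat] keep their type when the induction drops the last term. *)
suff h (b : nat -> K) :
    \sum_(i < n) b i *: v i = 0 -> forall i, (i < n)%N -> b i = 0.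
  move=> a0 i.
  pose b k := if insub k is Some j then a j else 0.
  have bE (j : 'I_n) : b j = a j by rewrite /b valK.
  rewrite -bE; apply: h => //.
  by rewrite -[RHS]a0; apply: eq_bigr => j _; rewrite bE.
elim: n {a} b => // n IH b; rewrite big_ord_recr/= => b0.
have bn : b n = 0.
  apply: contrapT => /eqP bn; apply: (vP n (fun i => - (b n)^-1 * b i)).
  under eq_bigr do rewrite -scalerA.
  rewrite -scaler_sumr; apply: (scalerI bn).
  rewrite scalerA mulrN divff// scaleN1r; apply/eqP.
  by rewrite -addr_eq0 addrC b0.
move: b0; rewrite bn scale0r addr0 => /IH{}IH i; rewrite ltnS leq_eqVlt.
by move=> /orP[/eqP ->|/IH].
Qed.

(** There are [n.+1] unknown coefficients and [n] equations, so the matrix of the values [f j (v i)]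
    kills a nonzero row; freeness of [v] makes the resulting combination nonzero. *)
Lemma common_kernel_spanned (K : numFieldType) (X : lmodType K)
    (v : nat -> X) (f : nat -> {linear X -> K^o}) n :
  (forall n (a : 'I_n -> K),
    \sum_(i < n) a i *: v i = 0 -> forall i, a i = 0) ->
  exists x, [/\ spanned v x, x != 0 & forall j, (j < n)%N -> f j x = 0].
Proof.
move=> vfree.
pose A : 'M[K]_(n.+1, n) := \matrix_(i, j) f j (v i).
have /rowV0Pn[a /sub_kermxP aA a0] : kermx A != 0.
  by rewrite -mxrank_eq0 mxrank_ker -lt0n subn_gt0 ltnS rank_leq_col.
exists (\sum_i a 0 i *: v i); split; first exact: spanned_sum.
  apply: contra_neq a0 => /vfree a0; apply/rowP => i.
  by rewrite a0 mxE.
move=> j jn; rewrite linear_sum/=.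
have := congr1 (fun M : 'rV_n => M 0 (Ordinal jn)) aA.
rewrite !mxE => h; apply: etrans h; apply: eq_bigr => i _.
by rewrite linearZ/= !mxE.
Qed.

(** Combinations with coefficients in the dense sequence [delta] are coded by finite lists of pairs
    (coefficient index, vector index), hence by integers. *)
Lemma spanned_separable (K : numFieldType) (X : normedModType K)
    (v : nat -> X) (delta : nat -> K) :
  (forall (z e : K), 0 < e -> exists n, `|z - delta n| < e) ->
  exists d : nat -> X, forall x (e : K), spanned v x -> 0 < e ->
    exists n, `|x - d n| < e.
Proof.
move=> deltaP.
pose c (s : seq (nat * nat)) := \sum_(p <- s) delta p.1 *: v p.2.
exists (fun n => c (odflt [::] (unpickle n))) => x e sx.
suff h : 0 < e -> exists s, `|x - c s| < e.
  by move=> /h[s hs]; exists (pickle s); rewrite pickleK.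
elim: sx e => {x} [e e0|a i y _ IH e e0].
  by exists [::]; rewrite /c big_nil subr0 normr0.
have e2 : 0 < e / 2 by rewrite divr_gt0.
(* The added 1 avoids a division by zero when [v i] vanishes. *)
have v1 : 0 < 1 + `|v i| by rewrite ltr_pwDl.
have [s ys] := IH _ e2.
have [k ak] := deltaP a _ (divr_gt0 e2 v1).
exists ((k, i) :: s); rewrite /c big_cons/= -/(c s) opprD addrACA -scalerBl.
rewrite (splitr e) (le_lt_trans (ler_normD _ _))// ltr_leD//; last exact: ltW.
rewrite normrZ; apply: (@le_lt_trans _ _ (`|a - delta k| * (1 + `|v i|))).
  by rewrite ler_wpM2l// lerDr.
by rewrite -ltr_pdivlMr.
Qed.

Lemma exists_strictly_weaker_norm (K : numFieldType) (X : normedModType K) :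
  (forall A : set K, A !=set0 -> lbound A 0 -> infimums A !=set0) ->
  (exists delta : nat -> K,
    forall (z e : K), 0 < e -> exists n, `|z - delta n| < e) ->
  (forall d : X, exists f : {linear X -> K^o},
    `|d| <= `|f d| /\ forall x, `|f x| <= 2 * `|x|) ->
  infinite_dimensional X ->
  exists q : X -> K,
    [/\ (forall x y, q (x + y) <= q x + q y) /\
        (forall a x, q (a *: x) = `|a| * q x),
        forall x, 0 <= q x, forall x, q x = 0 -> x = 0,
        forall x, q x <= `|x| &
        forall e, 0 < e -> exists2 x, `|x| = 1 & q x <= e].
Proof.
move=> glb [delta deltaP] /choice[F FP] /infinite_dimensional_free[v vfree].
have [d dP] := spanned_separable v deltaP.
pose f j := F (d j).
(* The gauge of this [P] is the maximum of the distance to the span and of the weighted values of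
   the [f j]. The exponent [j.+1], rather than [j], absorbs the bound 2 on [f 0], so that the gauge
   is at most the norm. *)
pose P (M : K) x := [/\ 0 <= M, exists2 y, spanned v y & `|x - y| <= M &
  forall j, `|f j x| <= M * 2 ^+ j.+1].
have Pnorm x : P `|x| x.
  split=> //; first by exists 0; [exact: spanned0|rewrite subr0].
  move=> j; apply: (le_trans ((FP _).2 _)); rewrite mulrC ler_wpM2l//.
  by rewrite exprS ler_peMr// exprn_ege1// ler1n.
have [||||q [qD qZ q0 qle qlt]] := gauge_seminorm (P := P) glb.
- by move=> x; exists `|x|.
- by move=> M x [].
- move=> M M' x y [M0 [z sz xz] Mf] [M0' [z' sz' yz'] Mf']; split.
  + exact: addr_ge0.
  + exists (z + z'); first exact: spannedD.
    by rewrite opprD addrACA (le_trans (ler_normD _ _))// lerD.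
  + by move=> j; rewrite linearD mulrDl (le_trans (ler_normD _ _))// lerD.
- move=> M a x [M0 [z sz xz] Mf]; split; first exact: mulr_ge0.
  + exists (a *: z); first exact: spannedZ.
    by rewrite -scalerBr normrZ ler_wpM2l.
  + by move=> j; rewrite linearZ/= normrM -mulrA ler_wpM2l.
exists q; split => // [x qx0|x|e e0].
- have small e : 0 < e -> exists2 M, P M x & M < e.
    by move=> e0; apply: qlt; rewrite qx0.
  have fx0 j : f j x = 0.
    apply/eqP; rewrite -normr_le0; apply: ler_addgt0_real => // e e0.
    have /small[M [_ _ Mf] Me] : 0 < e / 2 ^+ j.+1.
      by rewrite divr_gt0// exprn_gt0.
    rewrite add0r (le_trans (Mf j))//.
    by rewrite -ler_pdivlMr ?exprn_gt0// ltW.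
  apply/eqP; rewrite -normr_le0; apply: ler_addgt0_real => // e e0.
  (* Some [d n] is within [e / 4] of [x]. As [f n] kills [x], the norm of [d n] is at most
     [|f n (d n - x)|], hence at most twice that distance; so [|x|] is at most three times
     [e / 4]. *)
  have e8 : 0 < e / 8 by rewrite divr_gt0.
  have [M [_ [y sy xy] _] Me] := small _ e8.
  have [n yn] := dP y _ sy e8.
  have xd : `|x - d n| <= e / 8 + e / 8.
    rewrite -(subrKA y) (le_trans (ler_normD _ _))//.
    by apply: lerD; apply: ltW => //; exact: le_lt_trans Me.
  have dn : `|d n| <= 2 * `|x - d n|.
    apply: (le_trans (FP (d n)).1).
    rewrite -(distrC (d n)); apply: le_trans ((FP (d n)).2 _).
    by rewrite linearB -/(f n) fx0 subr0.
  rewrite add0r -[x](subrK (d n)) (le_trans (ler_normD _ _))//.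
  apply: (@le_trans _ _ (3 * `|x - d n|)).
    by rewrite (natrD _ 1 2) mulrDl mul1r lerD2l.
  apply: (@le_trans _ _ (3 * (e / 8 + e / 8))); first by rewrite ler_wpM2l.
  rewrite -mulr2n -[X in 3 * X]mulr_natl mulrA -natrM mulrCA.
  by rewrite ler_piMr ?(ltW e0)// ler_pdivrMr// mul1r ler_nat.
- exact: qle.
(* The Archimedean property comes from greatest lower bounds: if [m] is that of the powers, then
   [m + m] is again a lower bound, which is impossible for [m >= e > 0]. *)
- have [n ne] : exists n, (2 ^+ n)^-1 <= e.
    have [||m [mlb mglb]] := glb (range (fun n => (2 ^+ n)^-1 : K)).
    + by exists 1, 0%N; rewrite // expr0 invr1.
    + by move=> _ [n _ <-]; rewrite invr_ge0 exprn_ge0.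
    apply: contrapT => h.
    have em : e <= m.
      apply: mglb => _ [n _ <-].
      rewrite real_leNgt ?gtr0_real ?invr_gt0 ?exprn_gt0//.
      by apply/negP => /ltW ?; apply: h; exists n.
    have : m + m <= m.
      apply: mglb => _ [n _ <-].
      rewrite -mulr2n -[m *+ 2]mulr_natl -ler_pdivlMl// -invfM -exprS.
      by apply: mlb; exists n.+1.
    by rewrite gerDl => /(le_trans em)/(lt_le_trans e0); rewrite ltxx.
  have [x [sx x0 fx]] := common_kernel_spanned f n vfree.
  have x1 : `| `|x|^-1 *: x| = 1.
    by rewrite normrZ normfV normr_id mulVf// normr_eq0.
  exists (`|x|^-1 *: x) => //; apply: le_trans ne; apply: qle; split.
  + by rewrite invr_ge0 exprn_ge0.
  + exists (`|x|^-1 *: x); first exact: spannedZ.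
    by rewrite subrr normr0 invr_ge0 exprn_ge0.
  + move=> j; have [jn|nj] := ltnP j n.
      by rewrite linearZ/= fx// scaler0 normr0 mulr_ge0 ?invr_ge0 ?exprn_ge0.
    (* For [j >= n] the weight alone suffices: the value is at most 2, and
       [2 ^+ n.+1 <= 2 ^+ j.+1]. *)
    apply: le_trans ((FP _).2 _) _; rewrite x1 mulr1 ler_pdivlMl ?exprn_gt0//.
    by rewrite -exprSr ler_eXn2l// ltr1n.
Qed.

(** * Sublinear functionals and the Hahn-Banach theorem over the reals *)

Definition sublinear (R : realType) (X : lmodType R) (p : X -> R) :=
  (forall x y, p (x + y) <= p x + p y) /\
  (forall t x, 0 < t -> p (t *: x) = t * p x).

Lemma sublinear0 (R : realType) (X : lmodType R) (p : X -> R) :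
  sublinear p -> p 0 = 0.
Proof.
move=> [_ pZ]; have := pZ 2 0 (ltr0n _ 2); rewrite scaler0 mulr_natl mulr2n.
by move=> /eqP; rewrite -[X in X == _]addr0 (inj_eq (addrI _)) => /eqP.
Qed.

Lemma sublinearN (R : realType) (X : lmodType R) (p : X -> R) x :
  sublinear p -> - p (- x) <= p x.
Proof.
by move=> sp; rewrite lerNl -subr_ge0 opprK -(sublinear0 sp) -(addNr x) sp.1.
Qed.

(** A gauge that may take negative values, the lower bound depending on [x]. It produces both the
    translates of a sublinear functional and the infima of chains. *)
Lemma inf_sublinear (R : realType) (X : lmodType R) (P : R -> X -> Prop) :
  (forall x, exists M, P M x) ->
  (forall x, exists b, forall M, P M x -> b <= M) ->
  (forall M M' x y, P M x -> P M' y -> P (M + M') (x + y)) ->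
  (forall t M x, 0 < t -> P M x -> P (t * M) (t *: x)) ->
  exists2 q, sublinear q & forall M x, P M x -> q x <= M.
Proof.
move=> Pne Plb PD PZ; pose q x := inf [set M | P M x].
have qle M x : P M x -> q x <= M.
  by move=> PM; apply: ge_inf => //; have [b hb] := Plb x; exists b.
have qge b x : (forall M, P M x -> b <= M) -> b <= q x.
  by move=> h; apply: lb_le_inf; [exact: Pne|].
have qZ t x : 0 < t -> q (t *: x) <= t * q x.
  move=> t0; rewrite -ler_pdivrMl//; apply: qge => M PM.
  by rewrite ler_pdivrMl//; apply/qle/PZ.
exists q => //; split.
- move=> x y; rewrite -lerBlDr; apply: (qge _ _) => M PM.
  rewrite lerBlDl -lerBlDr; apply: qge => M' PM'.
  by rewrite lerBlDl; apply/qle/PD.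
- move=> t x t0; apply/le_anti; rewrite qZ//= -ler_pdivlMl//.
  have := @qZ t^-1 (t *: x); rewrite invr_gt0 => /(_ t0).
  by rewrite scalerA mulVf ?gt_eqF// scale1r.
Qed.

(** Take for [r x] the infimum of [p (x + t *: d) - t * p d] over [t >= 0]; the values at [t = 0]
    and [t = 1] give the two bounds. *)
Lemma sublinear_translate (R : realType) (X : lmodType R) (p : X -> R) d :
  sublinear p ->
  exists r, [/\ sublinear r, forall x, r x <= p x &
    forall x, r x <= p (x + d) - p d].
Proof.
move=> sp; have [pD pZ] := sp.
pose P M x := exists2 t, 0 <= t & p (x + t *: d) - t * p d <= M.
have [||||r sr rle] := @inf_sublinear R X P.
- by move=> x; exists (p (x + 0 *: d) - 0 * p d), 0.
(* Subadditivity gives [p (t *: d) <= p (x + t *: d) + p (- x)]. *)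
- move=> x; exists (- p (- x)) => M [t t0]; apply: le_trans.
  have tp : p (t *: d) = t * p d.
    move: t0; rewrite le_eqVlt => /orP[/eqP <-|/pZ//].
    by rewrite scale0r mul0r sublinear0.
  rewrite lerBrDr addrC lerBlDr -tp; apply: le_trans (pD _ _).
  by rewrite addrAC subrr add0r.
- move=> M M' x y [t t0 h] [t' t0' h']; exists (t + t'); first exact: addr_ge0.
  apply: le_trans (lerD h h'); rewrite addrACA -opprD -mulrDl lerD2r.
  by rewrite scalerDl addrACA.
- move=> s M x s0 [t t0 h]; exists (s * t); first by rewrite mulr_ge0// ltW.
  by rewrite -scalerA -scalerDr pZ// -mulrA -mulrBr ler_pM2l.
exists r; split => // x; apply: rle.
- by exists 0; rewrite // scale0r mul0r addr0 subr0.
- by exists 1; rewrite // scale1r mul1r.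
Qed.

(* A minimal sublinear functional is additive, since by
   [sublinear_translate] it coincides with its own translates. *)
Lemma sublinear_minorant (R : realType) (X : lmodType R) (p : X -> R) :
  sublinear p -> exists u : {linear X -> R^o}, forall x, u x <= p x.
Proof.
move=> sp.
pose T := {q : X -> R | sublinear q /\ forall x, q x <= p x}.
(* The order is reversed, so that a maximal element for Zorn's lemma is a minimal sublinear
   functional. *)
pose rel (a b : T) := `[< forall x, sval b x <= sval a x >].
have [||||[q [sq qp]] qmin] := @Zorn T rel.
- by move=> a; apply/asboolP.
- move=> a b c /asboolP ab /asboolP bc; apply/asboolP => x.
  exact: le_trans (bc x) (ab x).
- move=> [a ?] [b ?] /asboolP /= ab /asboolP /= ba; apply: eq_exist.
  by apply/funext => x; apply/le_anti; rewrite ab ba.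
- move=> A Atot.
  have [->|/set0P[a Aa]] := eqVneq A set0.
    by exists (exist _ p (conj sp (fun x => lexx _))).
  pose P M x := exists2 b, A b & sval b x <= M.
  have [||||r sr rle] := @inf_sublinear R X P.
  + by move=> x; exists (sval a x), a.
  + move=> x; exists (- p (- x)) => M [[b [sb bp]] _] /=; apply: le_trans.
    by apply: le_trans (sublinearN _ sb); rewrite lerN2.
  + move=> M M' x y [b Ab bM] [b' Ab' bM'].
    have [/asboolP bb'|/asboolP bb'] := Atot _ _ Ab Ab'.
    * exists b' => //; apply: le_trans (lerD (le_trans (bb' x) bM) bM').
      by have [[]] := svalP b'.
    * exists b => //; apply: le_trans (lerD bM (le_trans (bb' y) bM')).
      by have [[]] := svalP b.
  + move=> t M x t0 [b Ab bM]; exists b => //.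
    by have [[_ ->//]] := svalP b; rewrite ler_pM2l.
  have ra b x : A b -> r x <= sval b x by move=> Ab; apply: rle; exists b.
  have rp x : r x <= p x.
    by apply: le_trans (ra _ x Aa) _; have [_] := svalP a.
  by exists (exist _ r (conj sr rp)) => b Ab; apply/asboolP => x; exact: ra.
have qD x y : q (x + y) = q x + q y.
  apply/le_anti; rewrite sq.1/=.
  have [r [sr rq rqd]] := sublinear_translate y sq.
  (* By minimality [r] equals [q], so [q x <= q (x + y) - q y]. *)
  have rp z : r z <= p z by exact: le_trans (rq z) (qp z).
  have /(congr1 sval)/= rE :
      exist _ r (conj sr rp) = exist _ q (conj sq qp) :> T.
    by apply: qmin; exact/asboolP.
  by rewrite -lerBrDr -[X in X x]rE.
have qN x : q (- x) = - q x.
  by apply/eqP; rewrite -addr_eq0 -qD addNr sublinear0.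
have q_linear : linear (q : X -> R^o).
  move=> a x y; rewrite qD; congr (_ + _).
  have [a0|a0|->] := ltgtP a 0.
  - rewrite -[a]opprK scaleNr qN sq.2 ?oppr_gt0//.
    by rewrite [RHS]/GRing.scale/= opprK mulNr opprK.
  - by rewrite sq.2.
  - by rewrite !scale0r sublinear0.
pose u : {linear X -> R^o} :=
  HB.pack (q : X -> R^o) (GRing.isLinear.Build _ _ _ _ (q : X -> R^o) q_linear).
by exists u => x; exact: qp.
Qed.

(** A linear minorant [u] of the translate [r] by [d] satisfies [u (- d) <= r (- d) <= p 0 - p d],
    that is, [p d <= u d]. *)
Lemma hahn_banach_norming (R : realType) (X : lmodType R) (p : X -> R) d :
  sublinear p ->
  exists u : {linear X -> R^o}, p d <= u d /\ forall x, u x <= p x.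
Proof.
move=> sp; have [r [sr rp rd]] := sublinear_translate d sp.
have [u ur] := sublinear_minorant sr.
exists u; split => [|x]; last exact: le_trans (ur x) (rp x).
have := le_trans (ur (- d)) (rd (- d)).
by rewrite addNr sublinear0// add0r linearN lerN2.
Qed.

(** * Real scalars: norming functionals, infima and a dense sequence *)

(** The functional obtained has norm at most 1; the factor 2 gives the form shared with complex
    scalars. *)
Lemma normed_functional_real (R : realType) (X : normedModType R) (d : X) :
  exists f : {linear X -> R^o},
    `|d| <= `|f d| /\ forall x, `|f x| <= 2 * `|x|.
Proof.
have [|u [ud up]] := @hahn_banach_norming R X (fun x => `|x|) d.
  by split => [|t x t0]; [exact: ler_normD|rewrite normrZ gtr0_norm].
exists u; split => [|x]; first exact: le_trans ud (ler_norm _).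
apply: (@le_trans _ _ `|x|); last by rewrite ler_peMl// ler1n.
by rewrite ler_norml up lerNl -linearN -(normrN x) up.
Qed.

Lemma infimums_real (R : realType) (A : set R) :
  A !=set0 -> lbound A 0 -> infimums A !=set0.
Proof.
move=> A0 Alb; exists (inf A); split => [x Ax|b Ab].
  by apply: ge_inf => //; exists 0.
exact: lb_le_inf.
Qed.

Lemma dense_sequence_real (R : realType) :
  exists delta : nat -> R,
    forall (z e : R), 0 < e -> exists n, `|z - delta n| < e.
Proof.
exists (fun n => ratr (odflt 0 (unpickle n))) => z e e0.
have /rat_in_itvoo[q] : z < z + e by rewrite ltrDl.
rewrite in_itv/= => /andP[zq qz]; exists (pickle q); rewrite pickleK/=.
by rewrite distrC gtr0_norm ?subr_gt0// ltrBlDl.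
Qed.

(** * Complex scalars, by restriction to the reals *)

Definition realified (R : realType) (X : lmodType R[i]) : Type := X.

HB.instance Definition _ (R : realType) (X : lmodType R[i]) :=
  GRing.Zmodule.on (realified X).

Definition realified_scale (R : realType) (X : lmodType R[i]) (a : R)
  (x : realified X) : realified X := (a%:C)%C *: (x : X).

Lemma realified_scaleA (R : realType) (X : lmodType R[i]) a b
    (x : realified X) :
  realified_scale a (realified_scale b x) = realified_scale (a * b) x.
Proof. by rewrite /realified_scale scalerA -rmorphM. Qed.

Lemma realified_scale1 (R : realType) (X : lmodType R[i]) :
  left_id 1 (@realified_scale R X).
Proof. by move=> x; rewrite /realified_scale rmorph1 scale1r. Qed.

Lemma realified_scaleDr (R : realType) (X : lmodType R[i]) :
  right_distributive (@realified_scale R X) +%R.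
Proof. by move=> a x y; rewrite /realified_scale scalerDr. Qed.

Lemma realified_scaleDl (R : realType) (X : lmodType R[i]) (x : realified X) :
  {morph (@realified_scale R X)^~ x : a b / a + b}.
Proof. by move=> a b; rewrite /realified_scale rmorphD scalerDl. Qed.

HB.instance Definition _ (R : realType) (X : lmodType R[i]) :=
  GRing.Zmodule_isLmodule.Build R (realified X)
    (@realified_scaleA R X) (@realified_scale1 R X)
    (@realified_scaleDr R X) (@realified_scaleDl R X).

Lemma Re_norm (R : realType) (X : normedModType R[i]) (x : X) :
  ((Re `|x|)%:C)%C = `|x|.
Proof. by apply: RRe_real; exact: normr_real. Qed.

Lemma normc_le_Re_Im (R : realType) (z : R[i]) :
  `|z| <= (`|Re z|%:C + `|Im z|%:C)%C.
Proof.
case: z => a b /=; rewrite normc_def/= -rmorphD/= lecR.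
rewrite -[leRHS]ger0_norm ?addr_ge0// -sqrtr_sqr ler_wsqrtr//.
by rewrite sqrrD !real_normK ?num_real// addrAC lerDl mulrn_wge0// mulr_ge0.
Qed.

Lemma normed_functional_complex (R : realType) (X : normedModType R[i])
    (d : X) :
  exists f : {linear X -> R[i]^o},
    `|d| <= `|f d| /\ forall x, `|f x| <= 2 * `|x|.
Proof.
pose p (x : realified X) : R := Re `|x : X|.
have sp : sublinear p.
  split=> [x y|t x t0].
    by rewrite -lecR rmorphD/= !Re_norm ler_normD.
  apply: complexI; rewrite rmorphM/= !Re_norm normrZ ger0_norm//.
  by rewrite ler0c ltW.
have [u [ud up]] := @hahn_banach_norming R (realified X) p d sp.
pose i : R[i] := (0 +i* 1)%C.
(* The complex functional with real part [u]: complex linearity forces its imaginary part to be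
   [- u (i *: x)]. *)
pose f0 (x : X) : R[i]^o := (u x +i* - u (i *: x : X))%C.
have uN (x : X) : u (- x : X) = - u x by exact: (linearN u).
have uD (x y : X) : u (x + y : X) = u x + u y by exact: (linearD u).
have uZ (a : R) (x : X) : u ((a%:C)%C *: x : X) = a * u x.
  have : u (a *: (x : realified X)) = a *: u x by rewrite linearZ.
  exact.
have uabs (x : X) : (`|u x|%:C)%C <= `|x|.
  rewrite -Re_norm lecR ler_norml (up x) andbT lerNl -uN.
  by rewrite -(normrN x); exact: up.
have f0_linear : linear f0.
  case=> a b x y.
  have cE : (a +i* b)%C *: x = (a%:C)%C *: x + (b%:C)%C *: (i *: x).
    by rewrite scalerA -scalerDl; congr (_ *: _); rewrite /i; simpc.
  have icE : i *: ((a +i* b)%C *: x) = (a%:C)%C *: (i *: x) - (b%:C)%C *: x.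
    by rewrite !scalerA -scalerBl; congr (_ *: _); rewrite /i; simpc.
  rewrite /f0 scalerDr icE cE !uD !uN !uZ.
  have -> (z w : R[i]) : z *: (w : R[i]^o) = z * w by [].
  by simpc; rewrite [- _ + b * _]addrC.
pose f : {linear X -> R[i]^o} :=
  HB.pack f0 (GRing.isLinear.Build _ _ _ _ f0 f0_linear).
exists f; split => [|x].
  apply: le_trans (normc_ge_Re _); rewrite -Re_norm lecR.
  exact: le_trans ud (ler_norm _).
(* The constant 2 arises from bounding the real and imaginary parts separately, each by [|x|]. *)
apply: le_trans (normc_le_Re_Im _) _; rewrite /= normrN mulr_natl mulr2n.
rewrite lerD// (le_trans (uabs _))// normrZ.
by rewrite /i; simpc; rewrite /= expr0n expr1n add0r sqrtr1 mul1r.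
Qed.

(** Everything happens on the real axis: elements of [A] are nonnegative, hence real, and a lower
    bound is real because it is comparable with one of them. *)
Lemma infimums_complex (R : realType) (A : set R[i]) :
  A !=set0 -> lbound A 0 -> infimums A !=set0.
Proof.
move=> A0 Alb; pose B := [set Re a | a in A].
have AE a : A a -> a = ((Re a)%:C)%C.
  by move=> /Alb a0; rewrite RRe_real// ger0_real.
have Blb : lbound B 0.
  by move=> _ [a Aa <-]; rewrite -lecR -AE//; exact: Alb.
have [|m [mlb mglb]] := infimums_real _ Blb.
  by have [a Aa] := A0; exists (Re a), a.
exists (m%:C)%C; split => [a Aa|b blb].
  by rewrite (AE _ Aa) lecR; apply: mlb; exists a.
have bE : ((Re b)%:C)%C = b.
  apply: RRe_real; have [a Aa] := A0.
  by rewrite (ler_real (blb _ Aa)) ger0_real//; exact: Alb.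
rewrite -bE lecR; apply: mglb => _ [a Aa <-].
by rewrite -lecR bE -AE//; exact: blb.
Qed.

Lemma dense_sequence_complex (R : realType) :
  exists delta : nat -> R[i],
    forall (z e : R[i]), 0 < e -> exists n, `|z - delta n| < e.
Proof.
have [delta deltaP] := dense_sequence_real R.
exists (fun n => let: (j, k) := odflt (0, 0)%N (unpickle n) in
  (delta j +i* delta k)%C).
move=> [a b] e e0.
have eE : ((Re e)%:C)%C = e by apply: RRe_real; exact: gtr0_real.
have e2 : 0 < Re e / 2 by rewrite divr_gt0// -ltcR eE.
have [j aj] := deltaP a _ e2; have [k bk] := deltaP b _ e2.
exists (pickle (j, k)); rewrite pickleK/=.
apply: le_lt_trans (normc_le_Re_Im _) _.
by rewrite -rmorphD/= -eE ltcR (splitr (Re e)) ltrD.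
Qed.

Theorem theorem2p10 (R : realType) :
  (forall X : completeNormedModType R, infinite_dimensional X ->
     exists Y : completeNormedModType R,
       isomorphic X Y /\ QMA X Y <> bounded_operators X Y) /\
  (forall X : completeNormedModType (complex R), infinite_dimensional X ->
     exists Y : completeNormedModType (complex R),
       isomorphic X Y /\ QMA X Y <> bounded_operators X Y).
Proof.
split=> X Xinf.
- have [q [[qD qZ] q0 q_eq0 qle q_small]] := exists_strictly_weaker_norm
    (@infimums_real R) (@dense_sequence_real R)
    (@normed_functional_real R X) Xinf.
  apply: (strictly_weaker_norm_not_QMA (C := 1) qD qZ q0 q_eq0 _ q_small).
  by move=> x; rewrite mul1r.
- have [q [[qD qZ] q0 q_eq0 qle q_small]] := exists_strictly_weaker_norm
    (@infimums_complex R) (@dense_sequence_complex R)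
    (@normed_functional_complex R X) Xinf.
  apply: (strictly_weaker_norm_not_QMA (C := 1) qD qZ q0 q_eq0 _ q_small).
  by move=> x; rewrite mul1r.
Qed.
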